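(* For each end-of-file dead segment language, considering variant S of the halting problem, $$\exists c > 0: \forall T \in \textnormal{three-way(S)}: \forall n_0 \in \mathbb{N}: \exists n \geq n_0: \frac{\overline h_T(n)}{p(n)} \geq c \wedge \frac{\overline d_T(n)}{p(n)} \geq c,$$ $$\exists c > 0: \forall T \in \textnormal{generic(S)}: \forall n_0 \in \mathbb{N}: \exists n \geq n_0: \frac{\overline d_T(n)}{p(n)} \geq c,$$ $$\exists c > 0: \forall T \in \textnormal{approx(S)}: \forall n_0 \in \mathbb{N}: \exists n \geq n_0: \frac{\overline h_T(n)+\overline d_T(n)}{p(n)} \geq c .$$
   Context: Programs are strings over a finite alphabet $\Sigma$ ($|\Sigma|\ge2$) in a Turing-complete programming language in which programs can enumerate, construct and run other programs; each program on each input halts or runs forever; $p(n)$ is the number of programs of size (length) $n$. The language is end-of-file dead segment if each program is the concatenation of an actual program, written in a self-delimiting language (the set of actual programs is decidable and none is a proper prefix of another), and a dead segment, an arbitrary string over $\Sigma$ extending to the end of the file; the actual program cannot read the dead segment, so the behaviour of a program on any input is determined by its actual program. Variant S: instances are programs; question: does the program halt when given itself (its whole text, including the dead segment) as input. A three-way tester always halts with ``yes'', ``no'' or ``I don't know'', where ``yes''/``no'' must be correct; a generic-case tester on each instance either halts with a correct ``yes''/``no'' or fails to halt; an approximating tester always halts with ``yes'' or ``no'', possibly incorrect. three-way(S), generic(S), approx(S) are the sets of these testers. An instance is hard for a tester unless the tester answers it correctly with ``yes'' or ``no''. $\overline h_T(n)$, $\overline d_T(n)$ are the numbers of hard halting and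 hard non-halting instances of size $n$. *)

(* Defs.v *)
From HB Require Import structures.
From mathcomp Require Import all_boot all_order all_algebra.
From mathcomp Require Import boolp reals.
Set Implicit Arguments.
Unset Strict Implicit.
Unset Printing Implicit Defensive.

Section Computability.
Variable Sigma : finType.

(* Kleene's partial recursive functions, in their version on words: arguments
   and results are in Sigma^*, primitive recursion peels off one letter of its
   first argument, and minimisation searches along a^0, a^1, a^2, ...
   [prf n] is the type of codes of n-ary functions. *)
Inductive prf : nat -> Type :=
| Empty n : prf n
| Succ (a : Sigma) : prf 1
| Proj n (i : 'I_n) : prf n
| Comp m n (f : prf m) (g : 'I_m -> prf n) : prf n
| Rec n (g : prf n) (h : Sigma -> prf n.+2) : prf n.+1
| Min n (a : Sigma) (f : prf n.+1) : prf n.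

Fixpoint rec_graph (G : seq Sigma -> Prop)
    (H : Sigma -> seq Sigma -> seq Sigma -> seq Sigma -> Prop)
    (x y : seq Sigma) : Prop :=
  match x with
  | [::] => G y
  | a :: x' => exists z, rec_graph G H x' z /\ H a x' z y
  end.

Definition min_graph (a : Sigma) (F : seq Sigma -> seq Sigma -> Prop)
    (y : seq Sigma) : Prop :=
  exists m, [/\ y = nseq m a, F (nseq m a) [::]
    & forall j, j < m -> exists2 z, z != [::] & F (nseq j a) z].

(* [eval f v y]: f is defined at v, with value y *)
Fixpoint eval n (f : prf n) : n.-tuple (seq Sigma) -> seq Sigma -> Prop :=
  match f in prf n return n.-tuple (seq Sigma) -> seq Sigma -> Prop with
  | Empty _ => fun _ y => y = [::]
  | Succ a => fun v y => y = a :: thead v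
  | Proj _ i => fun v y => y = tnth v i
  | Comp m _ f g => fun v y =>
      exists w : m.-tuple (seq Sigma),
        (forall i, eval (g i) v (tnth w i)) /\ eval f w y
  | Rec _ g h => fun v y =>
      let u := [tuple of behead v] in
      rec_graph (eval g u)
        (fun a x z => eval (h a) (cons_tuple x (cons_tuple z u))) (thead v) y
  | Min _ a f => fun v y => min_graph a (fun x => eval f (cons_tuple x v)) y
  end.

Definition recursive_set (A : pred (seq Sigma)) : Prop :=
  exists f : prf 1, forall w,
    exists y, eval f [tuple w] y /\ (A w <-> y = [::]).

End Computability.

(* [run p x] is [Some y] if program p halts on input x with output y, and
   [None] if it runs forever; it is meaningful only when [prog p]. *)
Record language (Sigma : finType) := Language {
  prog : pred (seq Sigma);
  run : seq Sigma -> seq Sigma -> option (seq Sigma)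
}.

Section Halting.
Variables (Sigma : finType) (L : language Sigma).

Definition turing_complete : Prop :=
  forall f : prf Sigma 1, exists p, prog L p /\
    forall x y, run L p x = Some y <-> eval f [tuple x] y.

(* In a Turing-complete language, a program can carry out any computable
   manipulation of strings; that it can moreover enumerate and run programs
   amounts to the computability of the following two operations. *)
Definition can_enumerate_programs : Prop :=
  exists e : prf Sigma 1,
    (forall x, exists y, eval e [tuple x] y /\ prog L y) /\
    (forall p, prog L p -> exists x, eval e [tuple x] p).

Definition can_run_programs : Prop :=
  exists u : prf Sigma 2, forall p, prog L p ->
    forall x y, eval u [tuple p; x] y <-> run L p x = Some y.

Definition programming_language : Prop :=
  [/\ turing_complete, can_enumerate_programs & can_run_programs].

Definition prefix_free (A : pred (seq Sigma)) : Prop :=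
  forall a b, A a -> A b -> prefix a b -> a = b.

(* A is the set of actual programs, d ranges over the dead segments. *)
Definition eof_dead_segment : Prop :=
  exists A : pred (seq Sigma),
    [/\ recursive_set A, prefix_free A,
        forall w, prog L w <-> exists a d, A a /\ w = a ++ d
      & forall a d x, A a -> run L (a ++ d) x = run L a x].

Definition halts_on_itself (p : seq Sigma) : Prop := run L p p <> None.

Inductive answer := Yes | No | DontKnow.

(* [text] is the convention by which the output of a tester spells an answer *)
Variable text : answer -> seq Sigma.

Definition answers (T p : seq Sigma) (b : answer) : Prop :=
  run L T p = Some (text b).

Definition correct (T p : seq Sigma) : Prop :=
  (answers T p Yes /\ halts_on_itself p) \/
  (answers T p No /\ ~ halts_on_itself p).

Definition three_way (T : seq Sigma) : Prop :=
  prog L T /\ forall p, prog L p -> correct T p \/ answers T p DontKnow.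

Definition generic (T : seq Sigma) : Prop :=
  prog L T /\ forall p, prog L p -> correct T p \/ run L T p = None.

Definition approx (T : seq Sigma) : Prop :=
  prog L T /\ forall p, prog L p -> answers T p Yes \/ answers T p No.

Definition num_programs (n : nat) : nat :=
  #|[set w : n.-tuple Sigma | prog L w]|.

Definition hard_halting (T : seq Sigma) (n : nat) : nat :=
  #|[set w : n.-tuple Sigma |
      `[< [/\ prog L w, halts_on_itself w & ~ correct T w] >]]|.

Definition hard_nonhalting (T : seq Sigma) (n : nat) : nat :=
  #|[set w : n.-tuple Sigma |
      `[< [/\ prog L w, ~ halts_on_itself w & ~ correct T w] >]]|.

End Halting.

(* Main.v *)
Require Import Defs.
From mathcomp Require Import all_boot all_order all_algebra.
From mathcomp Require Import boolp reals.
Set Implicit Arguments.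
Unset Strict Implicit.
Unset Printing Implicit Defensive.

Import Order.TTheory GRing.Theory Num.Theory.
Local Open Scope ring_scope.

(** Instances of length [n] have their program simulate, on their own text, the
    [n]-th program of the enumeration, and then halt exactly when a tester would
    thereby be refuted.  Since only the length is decoded, all the texts [a ++ d]
    of length [n], that is, a fraction at least [|Sigma|^-|a|] of the programs of
    that length, are hard at once, and [a] does not depend on the tester.  A
    tester is simulated at arbitrarily large lengths, because padding it with
    dead segments yields infinitely many programs of the same behaviour. *)

(** * Determinism of evaluation, and codes for basic word functions *)

Section Computability.
Variable Sigma : finType.
Implicit Types (a b : Sigma) (x y z w : seq Sigma).

Lemma eval_functional n (f : prf Sigma n) v y z :
  eval f v y -> eval f v z -> y = z.
Proof.
elim: f v y z => {n}
  [n|a|n i|m n f IHf g IHg|n g IHg h IHh|n a f IHf] v y z /=.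
- by move=> -> ->.
- by move=> -> ->.
- by move=> -> ->.
- move=> [w1 [g1 f1]] [w2 [g2 f2]].
  have eqw : w1 = w2 by apply: eq_from_tnth => i; apply: IHg (g1 i) (g2 i).
  by rewrite eqw in f1; apply: IHf f1 f2.
- elim: (thead v) y z => [|a x IHx] y z /=; first exact: IHg.
  move=> [y' [/IHx eqy Hy]] [z' [/eqy eqz Hz]].
  by rewrite eqz in Hy; apply: IHh Hy Hz.
- move=> [m [-> m0 mlt]] [m' [-> m0' mlt']].
  (* The smaller of two distinct exponents is a zero of [f] at which the other search demands a
     nonempty value. *)
  case: (ltngtP m m') => [lt|lt|-> //].
  + by case: (mlt' _ lt) => t /eqP nt /IHf /(_ m0).
  + by case: (mlt _ lt) => t /eqP nt /IHf /(_ m0').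
Qed.

Lemma eval_Comp1 n (f : prf Sigma 1) (g : prf Sigma n) v y :
  eval (Comp f (fun=> g)) v y <-> exists z, eval g v z /\ eval f [tuple z] y.
Proof.
split=> /= [[w [gw fw]]|[z [gz fz]]].
  exists (tnth w ord0); split=> //.
  by congr (eval f _ y): fw; apply: eq_from_tnth => i; rewrite (ord1 i).
by exists [tuple z]; split=> // i; rewrite (ord1 i).
Qed.

Definition computable (F : seq Sigma -> seq Sigma) :=
  exists f : prf Sigma 1, forall x y, eval f [tuple x] y <-> y = F x.

Lemma eval_const n w : exists f : prf Sigma n, forall v y, eval f v y <-> y = w.
Proof.
elim: w => [|a w [f fP]]; first by exists (Empty _ n).
exists (Comp (Succ a) (fun=> f)) => v y.
rewrite eval_Comp1 /=; split=> [[z [/fP -> ->]] //|->].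
by exists w; split=> //; apply/fP.
Qed.

(** [Rec] takes a separate step code for each letter, so a case distinction on the first letter is
    made when the codes are chosen, not computed inside them. *)
Lemma computable_rec (g : seq Sigma)
    (H : Sigma -> seq Sigma -> seq Sigma -> seq Sigma) F :
    (forall a, exists h : prf Sigma 2,
      forall x z y, eval h [tuple x; z] y <-> y = H a x z) ->
    F [::] = g -> (forall a x, F (a :: x) = H a x (F x)) ->
  computable F.
Proof.
move=> /choice [h hP] F0 FS; have [f fP] := eval_const 0 g.
exists (Rec f h) => x.
suff recP (u : 0.-tuple (seq Sigma)) y :
    rec_graph (eval f u) (fun a x z => eval (h a) (cons_tuple x (cons_tuple z u)))
      x y <-> y = F x by move=> y; apply: recP.
have tupleE x' z : cons_tuple x' (cons_tuple z u) = [tuple x'; z].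
  by rewrite (tuple0 u); apply: val_inj.
elim: x y => [|a x IHx] y /=; first by rewrite F0; apply: fP.
split=> [[z [/IHx -> ]]|->]; rewrite ?tupleE.
  by rewrite FS => /hP.
by exists (F x); rewrite tupleE; split; [apply/IHx | apply/hP].
Qed.

Lemma computable_eval_r F : computable F ->
  exists f : prf Sigma 2, forall x z y, eval f [tuple x; z] y <-> y = F z.
Proof.
move=> [f fP]; exists (Comp f (fun=> Proj _ (Ordinal (isT : 1 < 2)%N))) => x z y.
rewrite eval_Comp1 /=; split=> [[_ [-> /fP ->]] //|->].
by exists z; split=> //; apply/fP.
Qed.

Lemma computable_eval_l F : computable F ->
  exists f : prf Sigma 2, forall x z y, eval f [tuple x; z] y <-> y = F x.
Proof.
move=> [f fP]; exists (Comp f (fun=> Proj _ (Ordinal (isT : 0 < 2)%N))) => x z y.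
rewrite eval_Comp1 /=; split=> [[_ [-> /fP ->]] //|->].
by exists x; split=> //; apply/fP.
Qed.

Lemma computable_cons a : computable (cons a).
Proof. by exists (Succ a). Qed.

(** Induction on the constant: once the first letters agree, the tails are compared, using the tail
    argument of the recursion and ignoring the recursive value. *)
Lemma computable_eq_const w u v :
  computable (fun x => if x == w then u else v).
Proof.
elim: w => [|b w IHw].
  apply: (@computable_rec u (fun _ _ _ => v)) => // a.
  by have [f fP] := eval_const 2 v; exists f => *; apply: fP.
pose H a x z := if (a == b) && (x == w) then u else v.
apply: (@computable_rec v H) => // a; rewrite /H.
have [_|_] := eqVneq a b; first exact: computable_eval_l IHw.
by have [f fP] := eval_const 2 v; exists f => *; apply: fP.
Qed.

(** The code [t] yields the empty word exactly when the comparison has outcome [b], and it ignores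
    the search variable; so [Min] stops at exponent 0 or searches forever. *)
Lemma semidecide_eq_const (a0 : Sigma) w (b : bool) : exists f : prf Sigma 1,
  forall x, (exists y, eval f [tuple x] y) <-> (x == w) = b.
Proof.
have [t tP] := computable_eval_r (computable_eq_const w
  (if b then [::] else [:: a0]) (if b then [:: a0] else [::])).
exists (Min a0 t) => x.
have tupleE z : cons_tuple z [tuple x] = [tuple z; x] by apply: val_inj.
split=> /= [[y [m [_]]]|eqb].
  by rewrite tupleE => /tP; case: eqP; case: b {tP}.
by exists [::], 0%N; split=> //; rewrite tupleE; apply/tP;
   rewrite eqb; case: b {tP} eqb.
Qed.

(** * Numbering all words by a computable successor *)

(* Bijective base-[#|Sigma|] numeration, least significant letter first: the
   letter of rank [i] is the digit [i.+1]. *)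
Fixpoint numeral x : nat :=
  if x is a :: x' then (numeral x' * #|Sigma| + index a (enum Sigma)).+1 else 0.

Lemma index_enum_lt a : (index a (enum Sigma) < #|Sigma|)%N.
Proof. by rewrite cardE index_mem mem_enum. Qed.

Lemma numeral_inj : injective numeral.
Proof.
elim=> [|a x IHx] [|b y] //= [] eqn.
have gt0 : (0 < #|Sigma|)%N by apply/card_gt0P; exists a.
have [la lb] := (index_enum_lt a, index_enum_lt b).
have /(congr1 (divn^~ #|Sigma|)) := eqn.
rewrite !divnMDl // !divn_small // !addn0 => /IHx eqx.
move: eqn; rewrite eqx => /addnI /(congr1 (nth a (enum Sigma))).
by rewrite !nth_index ?mem_enum // => ->.
Qed.

(** Successor in this numeration, with the carry moving towards the tail; the default [a0] of [nth]
    is never returned as a default. *)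
Fixpoint increment (a0 : Sigma) x : seq Sigma :=
  if x is a :: x' then
    let i := (index a (enum Sigma)).+1 in
    if (i < #|Sigma|)%N then nth a0 (enum Sigma) i :: x'
    else nth a0 (enum Sigma) 0 :: increment a0 x'
  else [:: nth a0 (enum Sigma) 0].

Lemma numeral_increment a0 x : numeral (increment a0 x) = (numeral x).+1.
Proof.
have gt0 : (0 < #|Sigma|)%N by apply/card_gt0P; exists a0.
have idx i : (i < #|Sigma|)%N -> index (nth a0 (enum Sigma) i) (enum Sigma) = i.
  by move=> lti; rewrite index_uniq ?enum_uniq // -cardE.
elim: x => [|a x IHx] /=; first by rewrite idx.
case: ltnP => [lti|gei] /=; first by rewrite idx // addnS.
have /eqP eqi : (index a (enum Sigma)).+1 == #|Sigma|.
  by rewrite eqn_leq index_enum_lt.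
by rewrite IHx idx // addn0 -[in RHS]addnS eqi mulSn addnC.
Qed.

(** After [numeral x] increments the word reached has the same numeral as [x]. Lengths can thus
    serve as indices of all words. *)
Lemma increment_orbit a0 x : exists n, iter n (increment a0) [::] = x.
Proof.
exists (numeral x); apply: numeral_inj.
by elim: (numeral x) => //= n IHn; rewrite numeral_increment IHn.
Qed.

Lemma computable_increment a0 : computable (increment a0).
Proof.
pose c0 := nth a0 (enum Sigma) 0.
pose H a x z := let i := (index a (enum Sigma)).+1 in
  if (i < #|Sigma|)%N then nth a0 (enum Sigma) i :: x else c0 :: z.
apply: (@computable_rec [:: c0] H) => // a; rewrite /H /=.
have [_|_] := ltnP (index a (enum Sigma)).+1 #|Sigma|.
  exact: computable_eval_l (computable_cons _).
exact: computable_eval_r (computable_cons _).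
Qed.

(** Recursion over the letters, blind to which letters they are, lets a code depend on the length of
    its input alone. *)
Lemma computable_iter_size F w :
  computable F -> computable (fun x => iter (size x) F w).
Proof.
move=> cF; apply: (@computable_rec w (fun _ _ z => F z)) => // _.
exact: computable_eval_r.
Qed.

End Computability.

(** * Density of the extensions of a fixed prefix among the programs *)

Section Counting.
Variables (R : realType) (Sigma : finType) (L : language Sigma).

Lemma card_tuples_with_prefix (a : seq Sigma) n (S : {set n.-tuple Sigma}) :
    (size a <= n)%N -> (forall w : n.-tuple Sigma, prefix a w -> w \in S) ->
  (#|Sigma| ^ (n - size a) <= #|S|)%N.
Proof.
move=> le_an aS; rewrite -card_tuple.
have szP (d : (n - size a).-tuple Sigma) : size (a ++ d) == n.
  by rewrite size_cat size_tuple subnKC.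
have inj : injective (fun d => Tuple (szP d)).
  by move=> d e /(congr1 val) /= /eqP; rewrite eqseq_cat // eqxx => /eqP /val_inj.
rewrite -(card_imset _ inj); apply/subset_leq_card/subsetP => _ /imsetP [d _ ->].
by apply: aS; rewrite prefix_prefix.
Qed.

(** There are at most [#|Sigma| ^ n] programs and at least [#|Sigma| ^ (n - size a)] words in [S].
    The bound uses any [k] above [size a], so that one constant can serve two prefixes. *)
Lemma prefix_density (a : seq Sigma) n (S : {set n.-tuple Sigma}) k :
    (size a <= k)%N -> (k <= n)%N -> (0 < #|Sigma|)%N ->
    (forall w : n.-tuple Sigma, prefix a w -> w \in S) ->
    (forall d, prog L (a ++ d)) ->
  ((#|Sigma| ^ k)%:R^-1 : R) <= #|S|%:R / (num_programs L n)%:R.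
Proof.
move=> le_ak le_kn gt0 aS aL.
have le_an := leq_trans le_ak le_kn.
have pgt0 : (0 < num_programs L n)%N.
  apply: leq_trans (card_tuples_with_prefix le_an _); first by rewrite expn_gt0 gt0.
  by move=> w /prefixP [d wE]; rewrite inE wE.
rewrite ler_pdivlMr ?ltr0n // mulrC ler_pdivrMr ?ltr0n ?expn_gt0 ?gt0 //.
rewrite -natrM ler_nat.
apply: (@leq_trans (#|Sigma| ^ n)%N).
  by rewrite -card_tuple /num_programs max_card.
rewrite -[in leqLHS](subnK le_an) expnD leq_mul //.
  exact: card_tuples_with_prefix.
by rewrite leq_pexp2l.
Qed.

End Counting.

(** * Diagonal programs that decode only their length *)

Section Diagonal.
Variables (Sigma : finType) (L : language Sigma) (a0 : Sigma).
Hypothesis L_prog : programming_language L.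
Hypothesis L_eof : eof_dead_segment L.

(* [S n] is the program simulated by the diagonal programs of length [n]. *)
Lemma length_diagonalization : exists S : nat -> seq Sigma,
  (forall T, prog L T -> forall n0, exists2 n, (n0 <= n)%N &
     forall x, run L (S n) x = run L T x) /\
  (forall w b, exists a, forall d, prog L (a ++ d) /\
     (halts_on_itself L (a ++ d) <-> exists t,
        run L (S (size (a ++ d))) (a ++ d) = Some t /\ (t == w) = b)).
Proof.
case: L_prog L_eof => tc [e [e_total e_onto]] [u uP] [A [_ _ progP runP]].
have /choice [E EP] := e_total.
pose c n := iter n (increment a0) [::].
exists (E \o c); split=> [T /progP [a [d [Aa ->]]] n0|w b].
  (* Padding the actual program by [m.+1] letters makes it longer than the first [n0] enumerated
     programs, so its index is at least [n0]. *)
  pose m := \max_(i < n0) size (E (c i)).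
  have [x ex] : exists x, eval e [tuple x] (a ++ nseq m.+1 a0).
    by apply: e_onto; apply/progP; exists a, (nseq m.+1 a0).
  have [n cn] := increment_orbit a0 x.
  have En : E (c n) = a ++ nseq m.+1 a0.
    by rewrite /c cn; apply: eval_functional ex; case: (EP x).
  exists n => [|y]; last by rewrite /= En !runP.
  rewrite leqNgt; apply/negP => lt_n.
  have := @leq_bigmax _ (fun i : 'I_n0 => size (E (c i))) (Ordinal lt_n).
  by rewrite /= En -/m size_cat size_nseq addnS ltnNge leq_addl.
have [clock clockP] := computable_iter_size [::] (computable_increment a0).
have [halt haltP] := semidecide_eq_const a0 w b.
(* The universal code receives the program indexed by the length of the input, and the input
   itself. *)
pose args (i : 'I_2) : prf Sigma 1 :=
  if i == ord0 then Comp e (fun=> clock) else Proj _ ord0.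
(* Only the actual part [a] of the program found is kept: replacing its dead segment [d] by any [d']
   preserves the behaviour. *)
have [p [/progP [a [d [Aa ->]]] pP]] := tc (Comp halt (fun=> Comp u args)).
have argsP x t : eval (Comp u args) [tuple x] t <->
    run L (E (c (size x))) x = Some t.
  have [Ex px] := EP (c (size x)).
  rewrite -uP //=; split=> [[v [vP]]|ut].
    congr eval; apply: eq_from_tnth => i.
    case: i (vP i) => [[|[|//]] lti]; last by move=> ->.
    move=> /eval_Comp1 [z [/clockP -> ez]].
    by rewrite (eval_functional ez Ex).
  exists [tuple E (c (size x)); x]; split=> // -[[|[|//]] lti] //.
  by apply/eval_Comp1; exists (c (size x)); split=> //; apply/clockP.
exists a => d'; split; first by apply/progP; exists a, d'.
rewrite /halts_on_itself runP // -(runP a d) //.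
set x := a ++ d'; split.
  case rx: run => [y|] // _; have /pP/eval_Comp1 [t [/argsP rt hy]] := rx.
  by exists t; split=> //; apply/haltP; exists y.
move=> [t [/argsP rt /haltP [y hy]]].
suff -> : run L (a ++ d) x = Some y by [].
by apply/pP/eval_Comp1; exists t.
Qed.

End Diagonal.

(** * Hard instances for the three kinds of testers *)

Theorem theorem6 (R : realType) (Sigma : finType) (L : language Sigma)
    (text : answer -> seq Sigma)
    (card_Sigma : (2 <= #|Sigma|)%N)
    (text_inj : injective text)
    (L_prog : programming_language L)
    (L_eof : eof_dead_segment L) :
  [/\ exists c : R, 0 < c /\
        forall T, three_way L text T ->
        forall n0 : nat, exists n : nat, (n0 <= n)%N /\
          (c <= (hard_halting L text T n)%:R / (num_programs L n)%:R /\
           c <= (hard_nonhalting L text T n)%:R / (num_programs L n)%:R),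
      exists c : R, 0 < c /\
        forall T, generic L text T ->
        forall n0 : nat, exists n : nat, (n0 <= n)%N /\
          c <= (hard_nonhalting L text T n)%:R / (num_programs L n)%:R
    & exists c : R, 0 < c /\
        forall T, approx L text T ->
        forall n0 : nat, exists n : nat, (n0 <= n)%N /\
          c <= (hard_halting L text T n + hard_nonhalting L text T n)%:R
               / (num_programs L n)%:R].
Proof.
have gt0 : (0 < #|Sigma|)%N by apply: leq_trans card_Sigma.
have [a0 _] := card_gt0P gt0.
have [S [S_onto S_diag]] := length_diagonalization a0 L_prog L_eof.
(* Texts over [a] halt when the simulated output exists and is not [text Yes], those over [b] when
   it is [text No]. The two differ on [text DontKnow]. *)
have [a aP] := S_diag (text Yes) false.
have [b bP] := S_diag (text No) true.
have aL d : prog L (a ++ d) by case: (aP d).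
have bL d : prog L (b ++ d) by case: (bP d).
have wrong T n (w : n.-tuple Sigma) : (forall x, run L (S n) x = run L T x) ->
    prefix a w \/ prefix b w -> ~ correct L text T w.
  (* Both halting conditions fail on [text Yes] and hold on [text No], so either prefix refutes both
     answers. *)
  move=> ST pre; have halts : halts_on_itself L w <-> exists t,
      run L T w = Some t /\ (if prefix a w then t != text Yes else t == text No).
    case: (boolP (prefix a w)) pre => [/prefixP [d wE] _|npre [|/prefixP [d wE]] //].
      have [_] := aP d; rewrite -wE size_tuple ST => ->.
      by split=> [[t [-> /negbT]]|[t [-> /negbTE]]]; exists t.
    by have [_] := bP d; rewrite -wE size_tuple ST => ->.
  have YN : text Yes != text No by apply/eqP => /text_inj.
  rewrite /correct /answers halts => -[[rT [t []]]|[rT nh]].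
    rewrite rT => -[<-]; case: ifP => _; first by rewrite eqxx.
    by rewrite (negbTE YN).
  by apply: nh; exists (text No); split=> //; case: ifP => _ //; rewrite eq_sym.
pose k := (size a + size b)%N.
have le_ak : (size a <= k)%N by apply: leq_addr.
have le_bk : (size b <= k)%N by apply: leq_addl.
have S_large T n0 : prog L T -> exists n,
    [/\ (n0 <= n)%N, (k <= n)%N & forall x, run L (S n) x = run L T x].
  move=> /S_onto /(_ (maxn n0 k)) [n]; rewrite geq_max => /andP [? ?] ?.
  by exists n.
have c_gt0 : 0 < ((#|Sigma| ^ k)%:R^-1 : R).
  by rewrite invr_gt0 ltr0n expn_gt0 gt0.
split; exists (#|Sigma| ^ k)%:R^-1; split=> // T [TL TP] n0;
  have [n [le_n0 le_k ST]] := S_large T n0 TL; exists n; split=> //.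
(* The tester can only answer [DontKnow], on which texts over [a] halt and those over [b] do not. *)
- split; [apply: (prefix_density R le_ak) | apply: (prefix_density R le_bk)] => //
    w pw.
    have wrongw := wrong T n w ST (or_introl pw).
    have /prefixP [d wE] := pw.
    have wL : prog L w by rewrite wE.
    rewrite inE; apply/asboolP; split=> //.
    have [//|rT] := TP w wL.
    have [_] := aP d; rewrite -wE size_tuple ST => ->.
    exists (text DontKnow); split=> //.
    by apply/negbTE/eqP => /text_inj.
  have wrongw := wrong T n w ST (or_intror pw).
  have /prefixP [d wE] := pw.
  have wL : prog L w by rewrite wE.
  rewrite inE; apply/asboolP; split=> //.
  have [//|rT] := TP w wL.
  have [_] := bP d; rewrite -wE size_tuple ST => ->.
  by case=> t []; rewrite rT => -[<-] /eqP /text_inj.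
(* The tester must diverge on texts over [a], and then they diverge as well. *)
- apply: (prefix_density R le_ak) => // w pw.
  have wrongw := wrong T n w ST (or_introl pw).
  have /prefixP [d wE] := pw.
  have wL : prog L w by rewrite wE.
  rewrite inE; apply/asboolP; split=> //.
  have [//|rT] := TP w wL.
  have [_] := aP d; rewrite -wE size_tuple ST => ->.
  by rewrite rT => -[t []].
(* Whether a refuted text halts depends on the answer given, so both kinds are counted together. *)
- pose H := [set w : n.-tuple Sigma | `[< prog L w /\ ~ correct L text T w >]].
  have HE : (#|H| <= hard_halting L text T n + hard_nonhalting L text T n)%N.
    apply: leq_trans (leq_card_setU _ _); apply/subset_leq_card/subsetP => w.
    rewrite !inE => /asboolP [pw nc]; apply/orP.
    by case: (pselect (halts_on_itself L w)) => hw; [left|right]; apply/asboolP.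
  apply: (@le_trans _ _ (#|H|%:R / (num_programs L n)%:R)).
    apply: (prefix_density R le_ak) => // w pw.
    rewrite inE; apply/asboolP; split; last exact: wrong ST (or_introl pw).
    by have /prefixP [d ->] := pw.
  by rewrite ler_wpM2r ?invr_ge0 ?ler0n // ler_nat.
Qed.
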